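(* Let $\mathcal T_h$ be a conforming Cartesian rectangular mesh of a periodic rectangle $\Omega\subset\mathbb R^2$, $p\ge1$, and let the nodal density values satisfy $\rho_q>0$ and be fixed. Let $(e_h^-,\boldsymbol u_h^-)\mapsto(e_h^+,\boldsymbol u_h^+)$ be the velocity oscillation-elimination (OE) map defined in the context. Then on every element $K$ the map preserves element momentum, adds a nonnegative increment to $e_h$ at every node ($e_q^+\ge e_q^-$), and satisfies $$\sum_qM_q^K\rho_q\boldsymbol u_{h,q}^+=\sum_qM_q^K\rho_q\boldsymbol u_{h,q}^-,$$ $$\begin{aligned}\tfrac12\|\sqrt{\rho_h}\boldsymbol u_h^-\|_{X,h,K}^2-\tfrac12\|\sqrt{\rho_h}\boldsymbol u_h^+\|_{X,h,K}^2&=\tfrac12\sum_{\ell=1}^p\bigl[1-\mathcal D_{\ell,K}^2\bigr]\|\boldsymbol w_{\ell,K}\|_{\rho,K}^2\\&=(\rho_h(e_h^+-e_h^-),1)_{V,h,K}\ \ge0 .\end{aligned}$$ Hence one velocity-OE map preserves the collocated element fluid energy $(\rho_he_h,1)_{V,h,K}+\frac12\|\sqrt{\rho_h}\boldsymbol u_h\|_{X,h,K}^2$ and cannot reduce a positive nodal internal energy.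
   Context: **Nodes and products.** Each $K\in\mathcal T_h$ is an axis-parallel rectangle with side lengths $h_{x,K},h_{y,K}$. The nodes $x_q\in K$ are the $(p+1)^2$ tensor-product Gauss–Lobatto–Legendre (GLL) points of $K$, with weights $M_q^K=\frac{h_{x,K}h_{y,K}}4\omega_i\omega_j>0$ for $q=(i,j)$, $\omega_i$ being the $(p+1)$-point GLL weights on $[-1,1]$. $\mathbb Q^\ell(K)$: polynomials of degree $\le\ell$ in each variable. The fields $\rho_h,e_h$ and the three components of $\boldsymbol u_h$ restricted to $K$ are in $\mathbb Q^p(K)$ and are identified with their nodal values; subscript $q$ denotes the value at $x_q$. $(f,g)_{V,h,K}=\sum_{x_q\in K}M_q^Kf_qg_q$; $$(\boldsymbol v_h,\boldsymbol z_h)_{\rho,K}=\sum_{x_q\in K}M^K_q\rho_q\boldsymbol v_q\cdot\boldsymbol z_q,\qquad \|\boldsymbol v\|_{\rho,K}^2=(\boldsymbol v,\boldsymbol v)_{\rho,K}=\|\sqrt{\rho_h}\boldsymbol v\|_{X,h,K}^2 .$$ **Modal increments.** $P^\rho_{\ell,K}$ is the orthogonal projection in $(\cdot,\cdot)_{\rho,K}$ of $[\mathbb Q^p(K)]^3$ onto $[\mathbb Q^\ell(K)]^3$, $P^\rho_{-1,K}=0$, and $\boldsymbol w_{\ell,K}=(P^\rho_{\ell,K}-P^\rho_{\ell-1,K})\boldsymbol u_h^-$, $0\le\ell\le p$. **Damping factors.** For direction $I\in\{x,y\}$ let $F^\pm_{I,K}$ be the two faces of $K$ normal to $I$, and for a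 scalar piecewise polynomial $w_h$ and $0\le r\le p$ put $J_{r,I,K}(w_h)=\sum_{F\in\{F^-_{I,K},F^+_{I,K}\}}\bigl(\frac1{|F|}\int_F[\![\partial_I^rw_h]\!]^2ds\bigr)^{1/2}$, $[\![\cdot]\!]$ being the jump across $F$. Let $\mathcal X_{I,K}$ be the row/column of elements through $K$ extending in direction $I$; $\overline w_{I,K}$ the mean of $w_h$ over $\bigcup\mathcal X_{I,K}$; $\overline w_\Omega$ the mean over $\Omega$; $\Delta_\Omega(w_h)=\|w_h-\overline w_\Omega\|_{L^\infty(\Omega)}$; $\Delta_{I,K}(w_h)=\max\{\max_{K'\in\mathcal X_{I,K}}\|w_h-\overline w_{I,K}\|_{L^\infty(K')},\,10^{-6}\Delta_\Omega(w_h)\}$. With $\boldsymbol u_h=\boldsymbol u_h^-$ set $\Delta^u_{I,K}=\max_{d\in\{x,y,z\}}\Delta_{I,K}(u_{d,h})$ and $$\sigma^u_{r,I,K}=\max_{d\in\{x,y,z\}}\frac{(2r+1)h_{I,K}^r}{2\,r!}\frac{J_{r,I,K}(u_{d,h})}{\Delta^u_{I,K}},$$ where a component that is constant to roundoff contributes zero (in particular when the denominator vanishes). With the (given, piecewise polynomial) magnetic field $\boldsymbol B_h$, $\lambda_{M,I,K}=\frac{2p+1}{h_{I,K}}\max_{x_q\in K}\bigl(|u_{I,h}(x_q)|+\frac{|\boldsymbol B_h(x_q)|}{\sqrt{\rho_h(x_q)}}\bigr)$. For a time interval $\tau>0$ and a constant $s_M\ge0$, $$\mathcal D_{\ell,K}=\exp[-s_M\tau\Theta_{\ell,K}],\qquad\Theta_{\ell,K}=\sum_{I\in\{x,y\}}\lambda_{M,I,K}\sum_{r=0}^\ell\sigma^u_{r,I,K}.$$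 **Velocity-OE map.** At each node $x_q\in K$, $$\boldsymbol u_{h,q}^+=(\boldsymbol w_{0,K})_q+\sum_{\ell=1}^p\mathcal D_{\ell,K}(\boldsymbol w_{\ell,K})_q,\qquad e_q^+=e_q^-+\frac12\sum_{\ell=1}^p\bigl[1-\mathcal D_{\ell,K}^2\bigr]\,|(\boldsymbol w_{\ell,K})_q|^2 .$$ *)

(* Defs.v *)
From HB Require Import structures.
From mathcomp Require Import all_boot all_order all_algebra.
From mathcomp Require Import all_classical all_reals all_analysis.

Set Implicit Arguments.
Unset Strict Implicit.
Unset Printing Implicit Defensive.

Import Order.TTheory GRing.Theory Num.Theory.
Local Open Scope classical_set_scope.
Local Open Scope ring_scope.

(* Nodes and weights of Gauss-Lobatto quadrature for the Legendre weight 1 on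
   [-1, 1]: both end points are nodes and the rule is exact in degree 2p - 1
   (for {poly R}, size = degree + 1).  This determines nodes and weights. *)
Record gll (R : realType) (p : nat) := Gll {
  gll_node : 'I_p.+1 -> R;
  gll_weight : 'I_p.+1 -> R;
  gll_incr : forall i j : 'I_p.+1, (i < j)%N -> gll_node i < gll_node j;
  gll_first : gll_node ord0 = -1;
  gll_last : gll_node ord_max = 1;
  gll_exact : forall f : {poly R}, (size f <= p.*2)%N ->
    \sum_(i < p.+1) gll_weight i * f.[gll_node i]
      = Rintegral (@lebesgue_measure R) `[-1, 1] (fun t => f.[t]) }.

(* A conforming mesh of a rectangle by axis-parallel rectangles has no hanging
   nodes, so it is a tensor product of two one-dimensional grids; only
   [grid_x 0, ..., grid_x nx] and [grid_y 0, ..., grid_y ny] matter. *)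
Record mesh (R : realType) := Mesh {
  nx : nat;
  ny : nat;
  grid_x : nat -> R;
  grid_y : nat -> R;
  nx_gt0 : (0 < nx)%N;
  ny_gt0 : (0 < ny)%N;
  grid_x_incr : forall i, (i < nx)%N -> grid_x i < grid_x i.+1;
  grid_y_incr : forall j, (j < ny)%N -> grid_y j < grid_y j.+1 }.

Variant dir := Dx | Dy.

Definition perp (I : dir) : dir := if I is Dx then Dy else Dx.

Definition dot (R : realType) (v z : 'rV[R]_3) : R := \sum_(d < 3) v 0 d * z 0 d.

(* The velocity component u_I: components 0, 1, 2 are x, y, z. *)
Definition normal_comp (I : dir) : 'I_3 := if I is Dx then inord 0 else inord 1.

(* Bivariate polynomials follow polyXY: w.[x, y] evaluates the outer variable
   at x and the inner one at y. *)
Definition inQ (R : realType) (l : nat) (w : {poly {poly R}}) : bool :=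
  (size w <= l.+1)%N && (sizeY w <= l.+1)%N.

Definition partial (R : realType) (I : dir) (r : nat) (w : {poly {poly R}}) :
    {poly {poly R}} :=
  if I is Dx then w^`(r) else map_poly (fun c : {poly R} => c^`(r)) w.

Definition face_val (R : realType) (I : dir) (w : {poly {poly R}}) (a t : R) : R :=
  if I is Dx then w.[a, t] else w.[t, a].

Definition lagr (R : realType) (n : nat) (x : 'I_n -> R) (i : 'I_n) : {poly R} :=
  \prod_(j < n | j != i) ((x i - x j)^-1 *: ('X - (x j)%:P)).

Section Mesh.
Variables (R : realType) (T : mesh R).

Definition cell : Type := ('I_(nx T) * 'I_(ny T))%type.

(* Piecewise polynomials, discontinuous across faces. *)
Definition pwscal : Type := cell -> {poly {poly R}}.
Definition pwvec : Type := cell -> 'rV[{poly {poly R}}]_3.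

Definition component (v : pwvec) (d : 'I_3) : pwscal := fun K => v K 0 d.

Definition lo (I : dir) (K : cell) : R :=
  if I is Dx then grid_x T K.1 else grid_y T K.2.
Definition hi (I : dir) (K : cell) : R :=
  if I is Dx then grid_x T K.1.+1 else grid_y T K.2.+1.
Definition width (I : dir) (K : cell) : R := hi I K - lo I K.

Definition rect (K : cell) : set (R * R) :=
  `[lo Dx K, hi Dx K] `*` `[lo Dy K, hi Dy K].

(* The face F^+ is s = true and F^- is s = false; [ordS] and [ord_pred] wrap
   around, which is the periodicity of the domain. *)
Definition nbr (I : dir) (s : bool) (K : cell) : cell :=
  if I is Dx then ((if s then ordS K.1 else ord_pred K.1), K.2)
  else (K.1, (if s then ordS K.2 else ord_pred K.2)).

Definition side (I : dir) (s : bool) (K : cell) : R :=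
  if s then hi I K else lo I K.

Definition jump (I : dir) (s : bool) (K : cell) (w : pwscal) (t : R) : R :=
  face_val I (w K) (side I s K) t
  - face_val I (w (nbr I s K)) (side I (~~ s) (nbr I s K)) t.

Definition jump_norm (r : nat) (I : dir) (K : cell) (w : pwscal) : R :=
  \sum_(s : bool) Num.sqrt ((width (perp I) K)^-1 *
    Rintegral (@lebesgue_measure R) `[lo (perp I) K, hi (perp I) K]
      (fun t => jump I s K (fun K' => partial I r (w K')) t ^+ 2)).

Definition leb2 := (@lebesgue_measure R \x @lebesgue_measure R)%E.

Definition line (I : dir) (K : cell) : {set cell} :=
  if I is Dx then [set K' : cell | K'.2 == K.2]%SET
  else [set K' : cell | K'.1 == K.1]%SET.

Definition mean (S : {set cell}) (w : pwscal) : R :=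
  (\sum_(K in S) Rintegral leb2 (rect K) (fun z => (w K).[z.1, z.2]))
  / \sum_(K in S) width Dx K * width Dy K.

(* The norm of w - c in L^oo(K). *)
Definition Linf (K : cell) (w : pwscal) (c : R) : R :=
  fine ('N[leb2]_(+oo)
    [(fun z : R * R => ((w K).[z.1, z.2] - c)%:E) \_ (rect K)])%E.

Definition Delta_Omega (w : pwscal) : R :=
  \big[Num.max/0]_(K : cell) Linf K w (mean [set: cell]%SET w).

Definition Delta (I : dir) (K : cell) (w : pwscal) : R :=
  Num.max (\big[Num.max/0]_(K' in line I K) Linf K' w (mean (line I K) w))
          (10%:R ^- 6 * Delta_Omega w).

Definition Delta_u (I : dir) (K : cell) (u : pwvec) : R :=
  \big[Num.max/0]_(d < 3) Delta I K (component u d).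

(* [flat u d I K] is the implementation-dependent test declaring the component
   d of u to be constant to roundoff.  It is an arbitrary parameter: whatever
   it answers, a component that is exactly constant contributes zero, since
   its jumps vanish. *)
Variable flat : pwvec -> 'I_3 -> dir -> cell -> bool.

Definition sigma (r : nat) (I : dir) (K : cell) (u : pwvec) : R :=
  \big[Num.max/0]_(d < 3)
    (if flat u d I K || (Delta_u I K u == 0) then 0
     else r.*2.+1%:R * width I K ^+ r / (2 * r`!%:R)
          * (jump_norm r I K (component u d) / Delta_u I K u)).

Variables (p : nat) (G : gll R p).

Definition node : Type := ('I_p.+1 * 'I_p.+1)%type.

Definition coord (I : dir) (K : cell) (i : 'I_p.+1) : R :=
  lo I K + width I K * ((1 + gll_node G i) / 2).

Definition mass (K : cell) (q : node) : R :=
  width Dx K * width Dy K / 4 * gll_weight G q.1 * gll_weight G q.2.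

Definition val_at (K : cell) (q : node) (f : {poly {poly R}}) : R :=
  f.[coord Dx K q.1, coord Dy K q.2].

Definition vec_at (K : cell) (q : node) (v : 'rV[{poly {poly R}}]_3) : 'rV[R]_3 :=
  map_mx (val_at K q) v.

(* The element of Q^p(K) with given nodal values. *)
Definition interp (K : cell) (f : node -> R) : {poly {poly R}} :=
  \sum_(q : node) (f q)%:P%:P
    * (map_poly polyC (lagr (coord Dx K) q.1) * (lagr (coord Dy K) q.2)%:P).

(* (f, g)_{V,h,K} and ||v||_{X,h,K}^2 of nodal functions. *)
Definition prodV (K : cell) (f g : node -> R) : R :=
  \sum_(q : node) mass K q * f q * g q.

Definition sqnormX (K : cell) (v : node -> 'rV[R]_3) : R :=
  \sum_(q : node) mass K q * dot (v q) (v q).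

Variable rho : pwscal.

Definition rho_at (K : cell) (q : node) : R := val_at K q (rho K).

Definition prod_rho (K : cell) (v z : 'rV[{poly {poly R}}]_3) : R :=
  \sum_(q : node) mass K q * rho_at K q * dot (vec_at K q v) (vec_at K q z).

(* || sqrt(rho_h) v ||_{X,h,K}^2 *)
Definition sqnormX_sqrt_rho (K : cell) (v : 'rV[{poly {poly R}}]_3) : R :=
  sqnormX K (fun q => Num.sqrt (rho_at K q) *: vec_at K q v).

Definition inQ3 (l : nat) (v : 'rV[{poly {poly R}}]_3) : Prop :=
  forall d, inQ l (v 0 d).

Definition is_proj (l : nat) (K : cell) (v w : 'rV[{poly {poly R}}]_3) : Prop :=
  inQ3 l w /\ forall z, inQ3 l z -> prod_rho K (v - w) z = 0.

(* For l <= p, it exists and is unique when the nodal values of rho are positive. *)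
Definition proj (l : nat) (K : cell) (v : 'rV[{poly {poly R}}]_3) :
    'rV[{poly {poly R}}]_3 :=
  xget 0 [set w | is_proj l K v w].

Definition incr (l : nat) (u : pwvec) (K : cell) : 'rV[{poly {poly R}}]_3 :=
  proj l K (u K) - (if l is l'.+1 then proj l' K (u K) else 0).

Variable B : pwvec.

Definition lambda (I : dir) (K : cell) (u : pwvec) : R :=
  p.*2.+1%:R / width I K *
  \big[Num.max/0]_(q : node)
    (`|vec_at K q (u K) 0 (normal_comp I)|
     + Num.sqrt (dot (vec_at K q (B K)) (vec_at K q (B K)))
       / Num.sqrt (rho_at K q)).

Definition Theta (l : nat) (K : cell) (u : pwvec) : R :=
  \sum_(I <- [:: Dx; Dy]) lambda I K u * \sum_(0 <= r < l.+1) sigma r I K u.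

Variables sM tau : R.

Definition damp (u : pwvec) (l : nat) (K : cell) : R :=
  expR (- (sM * tau * Theta l K u)).

Definition OE_u (u : pwvec) : pwvec := fun K =>
  let uplus q := vec_at K q (incr 0 u K)
                 + \sum_(1 <= l < p.+1) damp u l K *: vec_at K q (incr l u K) in
  \row_(d < 3) interp K (fun q => uplus q 0 d).

Definition OE_e (u : pwvec) (e : pwscal) : pwscal := fun K =>
  interp K (fun q => val_at K q (e K)
    + 2^-1 * \sum_(1 <= l < p.+1) (1 - damp u l K ^+ 2)
        * dot (vec_at K q (incr l u K)) (vec_at K q (incr l u K))).

Definition energy (e : pwscal) (u : pwvec) (K : cell) : R :=
  prodV K (fun q => rho_at K q * val_at K q (e K)) (fun=> 1)
  + 2^-1 * sqnormX_sqrt_rho K (u K).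

End Mesh.

(* Main.v *)
(* The increments w_l = (P_l - P_{l-1}) u are pairwise orthogonal for the
   rho-weighted nodal product and sum to P_p u, which has the norm of u.  By
   Pythagoras, damping w_l by D_l removes the kinetic energy
   (1 - D_l^2) |w_l|^2 / 2, and this is what is added, node by node, to the
   internal energy; it is nonnegative because the damping exponents Theta_l are.
   Momentum is tested by constants, to which every w_l with l >= 1 is orthogonal.
   The weighted product is positive semidefinite because GLL weights are
   nonnegative, and the projections exist because the normal equations of a
   weighted least squares problem are always solvable. *)

Require Import Defs.
From HB Require Import structures.
From mathcomp Require Import all_boot all_order all_algebra.
From mathcomp Require Import all_classical all_reals all_analysis.
From mathcomp Require Import zify ring.

Set Implicit Arguments.
Unset Strict Implicit.
Unset Printing Implicit Defensive.

Import Order.TTheory GRing.Theory Num.Theory.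
Local Open Scope ring_scope.

(** * Solvability of weighted normal equations *)

(** If [v] is in the row space of [A] and [v *m A^T = 0], then [v *m v^T = 0], a sum of squares, so
    [v = 0]. Hence [A *m A^T] has the rank of [A], and its row space fills that of [A^T]. *)
Lemma trmx_sub_gram (F : realFieldType) (m n : nat) (A : 'M[F]_(m, n)) :
  (A^T <= A *m A^T)%MS.
Proof.
have cap0 : (A :&: kermx A^T)%MS = 0.
  apply/eqP/rowV0P => v; rewrite sub_capmx => /andP[/submxP[y vE]].
  rewrite sub_kermx => /eqP vA0.
  have : (v *m v^T) 0 0 = 0 by rewrite {2}vE trmx_mul mulmxA vA0 mul0mx mxE.
  rewrite mxE => /psumr_eq0P v0; apply/rowP => i; rewrite [RHS]mxE.
  have /v0 /(_ i isT) /eqP : forall j, true -> 0 <= v 0 j * v^T j 0.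
    by move=> j _; rewrite mxE -expr2 sqr_ge0.
  by rewrite mxE mulf_eq0 orbb => /eqP.
have := mxrank_mul_ker A A^T; rewrite cap0 mxrank0 addn0 => rkE.
have := mxrank_leqif_eq (submxMl A A^T); rewrite mxrank_tr rkE => -[_].
by rewrite eqxx => /esym/andP[].
Qed.

Lemma ex_weighted_least_squares (R : rcfType) (Q I : finType) (m : Q -> R)
    (g : I -> Q -> R) (v : Q -> R) :
  (forall q, 0 <= m q) ->
  exists c : I -> R, forall j,
    \sum_q m q * (v q - \sum_i c i * g i q) * g j q = 0.
Proof.
move=> m_ge0.
(* Square roots of the weights are absorbed into matrix and data, which leaves an unweighted Gram
   system. *)
pose A := \matrix_(i < #|I|, q < #|Q|)
  (Num.sqrt (m (enum_val q)) * g (enum_val i) (enum_val q)).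
pose V := \row_(q < #|Q|) (Num.sqrt (m (enum_val q)) * v (enum_val q)).
have /submxP[y yE] : (V *m A^T <= A *m A^T)%MS.
  exact: submx_trans (submxMl _ _) (trmx_sub_gram A).
exists (fun i => y 0 (enum_rank i)) => j.
have /(congr1 (fun M : 'rV[R]_#|I| => M 0 (enum_rank j))) :
    (V - y *m A) *m A^T = 0 by rewrite mulmxBl -mulmxA yE subrr.
rewrite [RHS]mxE => E; rewrite -[RHS]E [RHS]mxE (reindex _ (onW_bij _ (@enum_val_bij Q))) /=.
apply: eq_bigr => q _; rewrite !mxE (reindex _ (onW_bij _ (@enum_val_bij I))) /=.
rewrite enum_rankK mulrA; congr (_ * _).
rewrite -[m _ in LHS]sqr_sqrtr // expr2 -mulrA mulrC; congr (_ * _).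
rewrite mulrBr mulr_sumr; congr (_ - _); apply: eq_bigr => i _.
by rewrite enum_valK !mxE mulrCA.
Qed.

(** * Nonnegativity of the GLL weights *)

(** An end node needs only a linear factor to keep a constant sign on [-1, 1]; an interior node
    needs a square. This saves the two degrees that exactness in degree 2p - 1 demands. *)
Definition gll_test (R : realType) (p : nat) (G : gll R p) (j : 'I_p.+1) :
    {poly R} :=
  if j == ord0 then 'X + 1
  else if j == ord_max then 1 - 'X else ('X - (gll_node G j)%:P) ^+ 2.

Lemma gll_node_inj (R : realType) (p : nat) (G : gll R p) :
  injective (gll_node G).
Proof.
move=> i j eqij; apply/val_inj/eqP; case: ltngtP => // lij;
  by have := gll_incr G lij; rewrite eqij ltxx.
Qed.

Lemma gll_test_ge0 (R : realType) (p : nat) (G : gll R p) (j : 'I_p.+1) (t : R) :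
  -1 <= t <= 1 -> 0 <= (gll_test G j).[t].
Proof.
move=> /andP[t_ge t_le]; rewrite /gll_test; do 2?case: eqP => _; rewrite !hornerE.
- by rewrite -lerBlDr sub0r.
- by rewrite subr_ge0.
- by rewrite sqr_ge0.
Qed.

Lemma gll_test_node (R : realType) (p : nat) (G : gll R p) (j : 'I_p.+1) :
  (gll_test G j).[gll_node G j] = 0.
Proof.
rewrite /gll_test; case: eqP => [->|_]; first by rewrite gll_first !hornerE addNr.
case: eqP => [->|_]; first by rewrite gll_last !hornerE subrr.
by rewrite !hornerE subrr expr0n.
Qed.

Lemma gll_test_node_gt0 (R : realType) (p : nat) (G : gll R p) (i j : 'I_p.+1) :
  j != i -> 0 < (gll_test G j).[gll_node G i].
Proof.
move=> jNi; rewrite /gll_test; case: eqP => [j0|_].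
  rewrite !hornerE -ltrBlDr sub0r -(gll_first G); apply: gll_incr.
  by rewrite lt0n; apply: contra jNi => /eqP i0; rewrite j0; apply/eqP/val_inj.
case: eqP => [jm|_]; rewrite !hornerE.
  rewrite subr_gt0 -(gll_last G); apply: gll_incr.
  rewrite ltn_neqAle -ltnS ltn_ord andbT.
  by apply: contra jNi => /eqP im; rewrite jm; apply/eqP/val_inj.
rewrite lt_def sqr_ge0 andbT expf_eq0 /= subr_eq0.
by apply: contra jNi => /eqP /gll_node_inj ->.
Qed.

(** Adding the deficit at each end makes the count uniform in [j], ready for summation; [1 <= p]
    keeps the two end nodes distinct. *)
Lemma size_gll_test (R : realType) (p : nat) (G : gll R p) (j : 'I_p.+1) :
  (1 <= p)%N ->
  ((size (gll_test G j)).-1 + (j == ord0) + (j == ord_max) = 2)%N.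
Proof.
move=> p_ge1; rewrite /gll_test; case: eqP => [->|_].
  rewrite -polyC1 size_XaddC /= -val_eqE /=; by case: p p_ge1 G j.
case: eqP => _; last by rewrite size_exp_XsubC.
by rewrite -opprB -polyC1 size_polyN size_XsubC.
Qed.

(* The product of the [gll_test G j] over [j != i] has degree at most 2p - 1, is
   nonnegative on [-1, 1] and vanishes at every node but the i-th, where it is
   positive, so exactness reads off the sign of the i-th weight. *)
Lemma gll_weight_ge0 (R : realType) (p : nat) (G : gll R p) (i : 'I_p.+1) :
  (1 <= p)%N -> 0 <= gll_weight G i.
Proof.
move=> p_ge1; pose f := \prod_(j | j != i) gll_test G j.
have f_gt0 : 0 < f.[gll_node G i].
  by rewrite horner_prod prodr_gt0 // => j; exact: gll_test_node_gt0.
have size_test j := size_gll_test G j p_ge1.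
have size_f : (size f <= p.*2)%N.
  apply: leq_trans (size_poly_prod_leq _ _) _; rewrite leq_subLR.
  have /leq_ltn_trans -> // : (\sum_(j | j != i) size (gll_test G j) <=
      #|[pred j | j != i]| + \sum_(j | j != i) (size (gll_test G j)).-1)%N.
    rewrite -sum1_card -big_split /=; apply: leq_sum => j _.
    by rewrite add1n leqSpred.
  rewrite ltn_add2l.
  (* All factors together have degree 2(p + 1) - 2 = 2p; the omitted i-th one has degree at least
     1. *)
  have : (\sum_j ((size (gll_test G j)).-1 + (j == ord0) + (j == ord_max))
         = 2 * p.+1)%N.
    rewrite (eq_bigr (fun=> 2)) => [|j _]; last exact: size_test.
    by rewrite sum_nat_const card_ord mulnC.
  rewrite !big_split /= -!big_mkcond /= !big_pred1_eq (bigD1 i) //=.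
  have : (1 <= (size (gll_test G i)).-1)%N.
    have := size_test i; case: (eqVneq i ord0) => [->|]; last first.
      by case: (i == ord_max) => _; case: _.-1.
    by rewrite -val_eqE /= eq_sym -leqn0 leqNgt p_ge1; case: _.-1.
  by move: (\sum_(_ < _ | _) _)%N _.-1 => a b; lia.
have := gll_exact G size_f; rewrite (bigD1 i) //= big1 ?addr0 => [fE|j jNi].
  rewrite -(pmulr_lge0 _ f_gt0) fE; apply: Rintegral_ge0 => t /=.
  rewrite in_itv /= => t1.
  by rewrite horner_prod prodr_ge0 // => j _; exact: gll_test_ge0.
by rewrite horner_prod (bigD1 j) //= gll_test_node mul0r mulr0.
Qed.

(** * The spaces Q^l and nodal interpolation *)

(** [swapXY] is additive and turns the degree in the inner variable into an ordinary size, so both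
    bounds are handled alike. *)
Lemma inQE (R : realType) (l : nat) (f : {poly {poly R}}) :
  inQ l f = (size f <= l.+1)%N && (size (swapXY f) <= l.+1)%N.
Proof. by rewrite /inQ sizeYE. Qed.

Lemma inQB (R : realType) (l : nat) (f g : {poly {poly R}}) :
  inQ l f -> inQ l g -> inQ l (f - g).
Proof.
rewrite !inQE raddfB => /andP[fx fy] /andP[gx gy]; apply/andP.
by split; rewrite (leq_trans (size_polyD _ _))// geq_max size_polyN ?fx ?fy.
Qed.

Lemma inQ_leq (R : realType) (k l : nat) (f : {poly {poly R}}) :
  (k <= l)%N -> inQ k f -> inQ l f.
Proof.
move=> kl /andP[fx fy]; apply/andP.
by split; [exact: leq_trans fx _ | exact: leq_trans fy _].
Qed.

Lemma inQ_polyCC (R : realType) (l : nat) (c : R) : inQ l c%:P%:P.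
Proof.
by rewrite inQE swapXY_polyC map_polyC /= !size_polyC !(leq_trans (leq_b1 _)).
Qed.

Lemma inQ_poly (R : realType) (l : nat) (c : nat -> nat -> R) :
  inQ l (\poly_(a < l.+1) \poly_(b < l.+1) c a b).
Proof.
rewrite /inQ size_poly; apply/bigmax_leqP => a _; rewrite coef_poly.
by case: ifP => _; rewrite ?size_poly // size_poly0.
Qed.

Lemma horner2_inQ (R : realType) (l : nat) (f : {poly {poly R}}) (x y : R) :
  inQ l f ->
  f.[x, y] = \sum_(i : 'I_l.+1 * 'I_l.+1) f`_i.1`_i.2 * (x ^+ i.1 * y ^+ i.2).
Proof.
move=> /andP[fx fy].
rewrite (horner_coef_wide _ fx) horner_sum -(pair_bigA _ (fun a b : 'I_l.+1 =>
  f`_a`_b * (x ^+ a * y ^+ b))) /=.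
apply: eq_bigr => a _; rewrite hornerM horner_exp hornerC.
rewrite (horner_coef_wide _ (leq_trans (max_size_coefXY f a) fy)) mulr_suml.
by apply: eq_bigr => b _; rewrite -mulrA [y ^+ b * _]mulrC.
Qed.

Lemma lagr_node (R : realType) (n : nat) (x : 'I_n -> R) (i k : 'I_n) :
  injective x -> (lagr x i).[x k] = (i == k)%:R.
Proof.
move=> x_inj; rewrite /lagr horner_prod; case: eqVneq => [->|ik].
  rewrite big1 // => j jk; rewrite hornerZ hornerXsubC mulVf // subr_eq0.
  by apply: contra jk => /eqP /x_inj ->.
by rewrite (bigD1 k) 1?eq_sym //= hornerZ hornerXsubC subrr mulr0 mul0r.
Qed.

Lemma width_gt0 (R : realType) (T : mesh R) (I : dir) (K : cell T) :
  0 < width I K.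
Proof.
by case: I; rewrite /width subr_gt0 /= ?grid_x_incr ?grid_y_incr.
Qed.

Lemma coord_inj (R : realType) (T : mesh R) (p : nat) (G : gll R p) (I : dir)
    (K : cell T) : injective (Defs.coord G I K).
Proof.
move=> i j /addrI/(mulfI (lt0r_neq0 (width_gt0 I K))) /mulIf.
by rewrite invr_eq0 pnatr_eq0 => /(_ isT)/addrI/gll_node_inj.
Qed.

(** The Lagrange basis is dual to the distinct nodes. This reduces every claim about [OE_u] and
    [OE_e] to their nodal formulas. *)
Lemma val_at_interp (R : realType) (T : mesh R) (p : nat) (G : gll R p)
    (K : cell T) (f : node p -> R) (q : node p) :
  val_at G K q (interp G K f) = f q.
Proof.
rewrite /val_at /interp !horner_sum (bigD1 q) //= big1 ?addr0 => [|q' q'q].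
  rewrite !hornerM !hornerC horner_map /= hornerC.
  by rewrite !lagr_node ?eqxx ?mulr1 //; exact: coord_inj.
rewrite !hornerM !hornerC horner_map /= hornerC !lagr_node //;
  [|exact: coord_inj..].
rewrite -natrM mulnb; case: andP => [[/eqP e1 /eqP e2]|_]; last by rewrite mulr0.
by case/eqP: q'q; rewrite (surjective_pairing q') e1 e2 -surjective_pairing.
Qed.

Lemma mass_ge0 (R : realType) (T : mesh R) (p : nat) (G : gll R p) (K : cell T)
    (q : node p) : (1 <= p)%N -> 0 <= mass G K q.
Proof.
move=> p_ge1.
by rewrite !mulr_ge0 ?invr_ge0 ?gll_weight_ge0 // ltW // width_gt0.
Qed.

(** * Weighted products of nodal vector fields *)

Lemma dotC (R : realType) (v z : 'rV[R]_3) : dot v z = dot z v.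
Proof. by apply: eq_bigr => d _; rewrite mulrC. Qed.

Lemma dot_ge0 (R : realType) (v : 'rV[R]_3) : 0 <= dot v v.
Proof. by apply: sumr_ge0 => d _; rewrite -expr2 sqr_ge0. Qed.

Lemma dotZ (R : realType) (a : R) (v z : 'rV[R]_3) : dot (a *: v) z = a * dot v z.
Proof.
by rewrite /dot mulr_sumr; apply: eq_bigr => d _; rewrite mxE mulrA.
Qed.

Lemma dot_sumZ (R : realType) (n : nat) (a : 'I_n -> R) (f : 'I_n -> 'rV[R]_3)
    (z : 'rV[R]_3) : dot (\sum_i a i *: f i) z = \sum_i a i * dot (f i) z.
Proof.
rewrite /dot; under [RHS]eq_bigr do rewrite mulr_sumr.
rewrite exchange_big /=; apply: eq_bigr => d _; rewrite summxE mulr_suml.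
by apply: eq_bigr => i _; rewrite mxE mulrA.
Qed.

(** [prod_rho] is the case of weights [mass * rho_at]; arbitrary nodal functions are allowed so that
    damped sums of modes need not be written as polynomials. *)
Definition nodal_dot (R : realType) (Q : finType) (m : Q -> R)
  (v z : Q -> 'rV[R]_3) : R := \sum_q m q * dot (v q) (z q).

Lemma nodal_dotC (R : realType) (Q : finType) (m : Q -> R) (v z : Q -> 'rV[R]_3) :
  nodal_dot m v z = nodal_dot m z v.
Proof. by apply: eq_bigr => q _; rewrite dotC. Qed.

Lemma eq_nodal_dot (R : realType) (Q : finType) (m : Q -> R)
    (v v' z z' : Q -> 'rV[R]_3) :
  v =1 v' -> z =1 z' -> nodal_dot m v z = nodal_dot m v' z'.
Proof. by move=> vE zE; apply: eq_bigr => q _; rewrite vE zE. Qed.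

Lemma nodal_dot_sumZ (R : realType) (Q : finType) (m : Q -> R) (n : nat)
    (a : 'I_n -> R) (f : 'I_n -> Q -> 'rV[R]_3) (z : Q -> 'rV[R]_3) :
  nodal_dot m (fun q => \sum_i a i *: f i q) z = \sum_i a i * nodal_dot m (f i) z.
Proof.
rewrite /nodal_dot; under [RHS]eq_bigr do rewrite mulr_sumr.
rewrite exchange_big /=; apply: eq_bigr => q _; rewrite dot_sumZ mulr_sumr.
by apply: eq_bigr => i _; rewrite mulrCA.
Qed.

Lemma nodal_pythagoras (R : realType) (Q : finType) (m : Q -> R) (n : nat)
    (a : 'I_n -> R) (f : 'I_n -> Q -> 'rV[R]_3) :
  (forall i j, i != j -> nodal_dot m (f i) (f j) = 0) ->
  let v q := \sum_i a i *: f i q in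
  nodal_dot m v v = \sum_i a i ^+ 2 * nodal_dot m (f i) (f i).
Proof.
move=> f_orth v; rewrite nodal_dot_sumZ; apply: eq_bigr => i _.
rewrite nodal_dotC nodal_dot_sumZ (bigD1 i) //= big1 ?addr0 => [|j ji].
  by rewrite mulrA.
by rewrite f_orth // mulr0.
Qed.

Lemma vec_atE (R : realType) (T : mesh R) (p : nat) (G : gll R p) (K : cell T)
    (q : node p) (v : 'rV[{poly {poly R}}]_3) (d : 'I_3) :
  vec_at G K q v 0 d = val_at G K q (v 0 d).
Proof. exact: mxE. Qed.

Lemma vec_atB (R : realType) (T : mesh R) (p : nat) (G : gll R p) (K : cell T)
    (q : node p) : {morph vec_at G K q : v w / v - w}.
Proof. by move=> v w; apply/rowP => d; rewrite !mxE /val_at !hornerE. Qed.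

Lemma prod_rhoB (R : realType) (T : mesh R) (p : nat) (G : gll R p)
    (rho : pwscal T) (K : cell T) (v w z : 'rV[{poly {poly R}}]_3) :
  prod_rho G rho K (v - w) z = prod_rho G rho K v z - prod_rho G rho K w z.
Proof.
rewrite /prod_rho -sumrB; apply: eq_bigr => q _; rewrite -mulrBr vec_atB.
by congr (_ * _); rewrite /dot -sumrB; apply: eq_bigr => d _; rewrite !mxE mulrBl.
Qed.

Lemma prod_rhoC (R : realType) (T : mesh R) (p : nat) (G : gll R p)
    (rho : pwscal T) (K : cell T) (v z : 'rV[{poly {poly R}}]_3) :
  prod_rho G rho K v z = prod_rho G rho K z v.
Proof. exact: nodal_dotC. Qed.

(** * Projections and modal increments *)

Section Projection.
Variables (R : realType) (T : mesh R) (p : nat) (G : gll R p) (rho : pwscal T).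
Hypotheses (p_ge1 : (1 <= p)%N) (rho_gt0 : forall K q, 0 < rho_at G rho K q).

Lemma rho_mass_ge0 (K : cell T) (q : node p) : 0 <= mass G K q * rho_at G rho K q.
Proof. by rewrite mulr_ge0 ?mass_ge0 // ltW. Qed.

(** [proj] is a choice, so only existence is at stake: the product splits over the three components,
    each a least squares problem in tensor monomials. *)
Lemma projP (l : nat) (K : cell T) (v : 'rV[{poly {poly R}}]_3) :
  is_proj G rho l K v (Defs.proj G rho l K v).
Proof.
apply: (@xgetPex _ 0 [set w | is_proj G rho l K v w]%classic).
pose I : finType := ('I_l.+1 * 'I_l.+1)%type.
pose g (i : I) (q : node p) := Defs.coord G Dx K q.1 ^+ i.1 * Defs.coord G Dy K q.2 ^+ i.2.
have [c cP] := fin_all_exists (fun d : 'I_3 =>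
  ex_weighted_least_squares g (fun q => val_at G K q (v 0 d)) (rho_mass_ge0 K)).
pose w : 'rV[{poly {poly R}}]_3 :=
  \row_d \poly_(a < l.+1) \poly_(b < l.+1) c d (inord a, inord b).
have wQ : inQ3 l w by move=> d; rewrite mxE; exact: inQ_poly.
exists w; split=> // z zQ; rewrite /prod_rho /dot.
under eq_bigr do rewrite mulr_sumr.
rewrite exchange_big big1 //= => d _.
have wE q : val_at G K q (w 0 d) = \sum_i c d i * g i q.
  rewrite /val_at (horner2_inQ _ _ (wQ d)); apply: eq_bigr => i _.
  by rewrite mxE !coef_poly !ltn_ord coef_poly ltn_ord !inord_val -surjective_pairing.
(* The test field expands in the same monomials, so orthogonality to each [g i] suffices. *)
have zE q : val_at G K q (z 0 d) = \sum_(i : I) (z 0 d)`_i.1`_i.2 * g i q.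
  exact: horner2_inQ (zQ d).
transitivity (\sum_(i : I) (z 0 d)`_i.1`_i.2 *
    \sum_q mass G K q * rho_at G rho K q *
      (val_at G K q (v 0 d) - \sum_i c d i * g i q) * g i q).
  under [RHS]eq_bigr do rewrite mulr_sumr.
  rewrite exchange_big; apply: eq_bigr => q _ /=.
  rewrite vec_atB [X in _ * (X * _)]mxE [X in _ + X]mxE !vec_atE zE wE mulrA mulr_sumr; apply: eq_bigr => i _.
  by rewrite mulrCA.
by rewrite big1 // => i _; rewrite cP mulr0.
Qed.

Lemma prod_rho_proj (l : nat) (K : cell T) (v z : 'rV[{poly {poly R}}]_3) :
  inQ3 l z -> prod_rho G rho K (Defs.proj G rho l K v) z = prod_rho G rho K v z.
Proof.
by move=> /(projP l K v).2; rewrite prod_rhoB => /eqP; rewrite subr_eq0 => /eqP.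
Qed.

Lemma inQ3_incr (l : nat) (u : pwvec T) (K : cell T) : inQ3 l (incr G rho l u K).
Proof.
move=> d; rewrite /incr; case: l => [|l].
  by rewrite subr0; exact: (projP 0 K (u K)).1.
rewrite !mxE inQB //; first exact: (projP l.+1 K (u K)).1.
by apply: inQ_leq (leqnSn l) _; exact: (projP l K (u K)).1.
Qed.

(** Both projections in the increment have the same product with [z] as [u] itself, so they
    cancel. *)
Lemma incr_orthQ (l : nat) (u : pwvec T) (K : cell T) (z : 'rV[{poly {poly R}}]_3) :
  inQ3 l z -> prod_rho G rho K (incr G rho l.+1 u K) z = 0.
Proof.
move=> zQ; rewrite prod_rhoB !prod_rho_proj ?subrr //.
by move=> d; exact: inQ_leq (leqnSn l) (zQ d).
Qed.

(** The lower of two modes lies in a space to which the higher one is orthogonal. *)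
Lemma incr_orth (k l : nat) (u : pwvec T) (K : cell T) :
  k != l -> prod_rho G rho K (incr G rho k u K) (incr G rho l u K) = 0.
Proof.
wlog lk : k l / (l < k)%N.
  move=> th; rewrite neq_ltn => /orP[kl|lk]; last by rewrite th // gtn_eqF.
  by rewrite prod_rhoC th // gtn_eqF.
case: k lk => // k lk _; apply: incr_orthQ => d.
exact: inQ_leq (ltnSE lk) (inQ3_incr l u K d).
Qed.

(** Telescoping, starting from P_{-1} = 0. *)
Lemma sum_incr (n : nat) (u : pwvec T) (K : cell T) (q : node p) :
  \sum_(l < n.+1) vec_at G K q (incr G rho l u K)
    = vec_at G K q (Defs.proj G rho n K (u K)).
Proof.
elim: n => [|n IH]; first by rewrite big_ord1 /incr subr0.
by rewrite big_ord_recr /= IH /incr vec_atB addrC subrK.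
Qed.

(* The nodal values of the projection onto Q^p need not be compared with those
   of u: equality of the weighted norms suffices, so nonnegative GLL weights do. *)
Lemma prod_rho_projp (u : pwvec T) (K : cell T) :
  inQ3 p (u K) ->
  prod_rho G rho K (u K) (u K)
    = prod_rho G rho K (Defs.proj G rho p K (u K)) (Defs.proj G rho p K (u K)).
Proof.
move=> uQ; rewrite [RHS]prod_rho_proj; last exact: (projP p K (u K)).1.
by rewrite prod_rhoC prod_rhoC [RHS]prod_rhoC prod_rho_proj.
Qed.

Lemma sqnormX_sqrt_rhoE (K : cell T) (v : 'rV[{poly {poly R}}]_3) :
  sqnormX_sqrt_rho G rho K v = prod_rho G rho K v v.
Proof.
apply: eq_bigr => q _; rewrite dotZ dotC dotZ -[RHS]mulrA; congr (_ * _).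
by rewrite mulrA -expr2 sqr_sqrtr // ltW.
Qed.

(** Constant unit fields read off momentum components, so that conservation becomes a matter of
    orthogonality. *)
Lemma prod_rho_cst (K : cell T) (v : 'rV[{poly {poly R}}]_3) (d : 'I_3) :
  prod_rho G rho K v (delta_mx 0 d) =
  (\sum_q (mass G K q * rho_at G rho K q) *: vec_at G K q v) 0 d.
Proof.
rewrite summxE; apply: eq_bigr => q _; rewrite mxE /dot (bigD1 d) //= big1 ?addr0 => [|e ed].
  by rewrite !vec_atE mxE !eqxx /val_at !hornerC mulr1.
by rewrite !vec_atE mxE (negPf ed) andbF /val_at !horner0 mulr0.
Qed.

Lemma inQ3_delta (l : nat) (d : 'I_3) : inQ3 l (delta_mx 0 d : 'rV[{poly {poly R}}]_3).
Proof. by move=> e; rewrite mxE -!polyCMn; exact: inQ_polyCC. Qed.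

End Projection.

(** * Bounds on the damping factors *)

(** The maxima in [sigma] and [lambda] start from 0, so [Theta] is nonnegative whatever [flat]
    answers. *)
Lemma damp_le1 (R : realType) (T : mesh R) (p : nat) (G : gll R p)
    (rho : pwscal T) (B : pwvec T)
    (flat : pwvec T -> 'I_3 -> dir -> cell T -> bool) (sM tau : R)
    (u : pwvec T) (l : nat) (K : cell T) :
  0 <= sM -> 0 <= tau -> damp flat G rho B sM tau u l K <= 1.
Proof.
move=> sM_ge0 tau_ge0; rewrite expR_le1 oppr_le0 !mulr_ge0 //.
rewrite /Theta sumr_ge0 // => I _; rewrite mulr_ge0 //.
  by rewrite mulr_ge0 ?divr_ge0 ?bigmax_ge_id // ltW // width_gt0.
by apply: sumr_ge0 => r _; exact: bigmax_ge_id.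
Qed.

Lemma damp_factor_ge0 (R : realType) (T : mesh R) (p : nat) (G : gll R p)
    (rho : pwscal T) (B : pwvec T)
    (flat : pwvec T -> 'I_3 -> dir -> cell T -> bool) (sM tau : R)
    (u : pwvec T) (l : nat) (K : cell T) :
  0 <= sM -> 0 <= tau -> 0 <= 1 - damp flat G rho B sM tau u l K ^+ 2.
Proof.
by move=> ? ?; rewrite subr_ge0 expr_le1 ?damp_le1 ?expR_ge0.
Qed.

(** * Momentum and energy balance of the OE map *)

Theorem proposition1 (R : realType) (T : mesh R) (p : nat) (G : gll R p)
  (rho : pwscal T) (B : pwvec T)
  (flat : pwvec T -> 'I_3 -> dir -> cell T -> bool) (sM tau : R)
  (em : pwscal T) (um : pwvec T)
  (p_ge1 : (1 <= p)%N) (sM_ge0 : 0 <= sM) (tau_gt0 : 0 < tau)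
  (rhoQ : forall K, inQ p (rho K))
  (rho_gt0 : forall K q, 0 < rho_at G rho K q)
  (emQ : forall K, inQ p (em K))
  (umQ : forall K, inQ3 p (um K)) :
  let up := OE_u flat G rho B sM tau um in
  let ep := OE_e flat G rho B sM tau um em in
  let DK l K := damp flat G rho B sM tau um l K in
  let w l K := incr G rho l um K in
  let de K := prodV G K
    (fun q => rho_at G rho K q * (val_at G K q (ep K) - val_at G K q (em K)))
    (fun=> 1) in
  forall K : cell T,
    (forall q, val_at G K q (em K) <= val_at G K q (ep K)) /\
    \sum_(q : node p) (mass G K q * rho_at G rho K q) *: vec_at G K q (up K)
      = \sum_(q : node p) (mass G K q * rho_at G rho K q) *: vec_at G K q (um K) /\
    2^-1 * sqnormX_sqrt_rho G rho K (um K)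
      - 2^-1 * sqnormX_sqrt_rho G rho K (up K)
      = 2^-1 * \sum_(1 <= l < p.+1)
          (1 - DK l K ^+ 2) * prod_rho G rho K (w l K) (w l K) /\
    2^-1 * \sum_(1 <= l < p.+1)
        (1 - DK l K ^+ 2) * prod_rho G rho K (w l K) (w l K) = de K /\
    0 <= de K /\
    energy G rho ep up K = energy G rho em um K /\
    (forall q, 0 < val_at G K q (em K) ->
      0 < val_at G K q (ep K) /\ val_at G K q (em K) <= val_at G K q (ep K)).
Proof.
move=> up ep DK w de K.
(* Mode 0 is undamped; factor 1 makes the updated velocity a single sum over all modes. *)
pose a (l : 'I_p.+1) := if l == ord0 then 1 else DK l K.
pose f (l : 'I_p.+1) q := vec_at G K q (w l K).
pose m q := mass G K q * rho_at G rho K q.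
have wd_ge0 q : 0 <= 2^-1 * \sum_(1 <= l < p.+1)
    (1 - DK l K ^+ 2) * dot (vec_at G K q (w l K)) (vec_at G K q (w l K)).
  rewrite mulr_ge0 // sumr_ge0 // => l _.
  by rewrite mulr_ge0 ?dot_ge0 // damp_factor_ge0 // ltW.
have eE q : val_at G K q (ep K) - val_at G K q (em K) = 2^-1 *
    \sum_(1 <= l < p.+1) (1 - DK l K ^+ 2) *
      dot (vec_at G K q (w l K)) (vec_at G K q (w l K)).
  by rewrite val_at_interp addrC addKr.
have e_le q : val_at G K q (em K) <= val_at G K q (ep K).
  by rewrite -subr_ge0 eE.
have upE q : vec_at G K q (up K) = \sum_l a l *: f l q.
  apply/rowP => d; rewrite vec_atE mxE val_at_interp; congr (fun_of_matrix _ 0 d).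
  by rewrite big_ord_recl scale1r big_add1 big_mkord.
have f_orth i j : i != j -> nodal_dot m (f i) (f j) = 0.
  by move=> ij; exact: incr_orth.
have up_sq : prod_rho G rho K (up K) (up K) =
    \sum_l a l ^+ 2 * prod_rho G rho K (w l K) (w l K).
  by rewrite -(nodal_pythagoras _ f_orth); exact: eq_nodal_dot.
have um_sq : prod_rho G rho K (um K) (um K) =
    \sum_(l < p.+1) prod_rho G rho K (w l K) (w l K).
  rewrite prod_rho_projp //.
  (* Coefficients 1 = 1^2 are inserted so that Pythagoras also covers the undamped sum of modes. *)
  rewrite -[RHS](eq_bigr _ (fun l _ => mul1r (nodal_dot m (f l) (f l)))).
  rewrite -(eq_bigr _ (fun l _ => congr2 *%R (expr1n R 2) erefl)).
  rewrite -(nodal_pythagoras (fun=> 1) f_orth).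
  by apply: eq_nodal_dot => q; under eq_bigr do rewrite scale1r; rewrite sum_incr.
have diffE : 2^-1 * sqnormX_sqrt_rho G rho K (um K)
      - 2^-1 * sqnormX_sqrt_rho G rho K (up K)
    = 2^-1 * \sum_(1 <= l < p.+1)
        (1 - DK l K ^+ 2) * prod_rho G rho K (w l K) (w l K).
  (* The difference has coefficients 1 - [a l ^+ 2], and its term for mode 0 vanishes. *)
  rewrite !sqnormX_sqrt_rhoE // um_sq up_sq -mulrBr -sumrB big_ord_recl.
  rewrite expr1n mul1r subrr add0r big_add1 big_mkord; congr (_ * _).
  by apply: eq_bigr => l _; rewrite mulrBl mul1r.
have deE : 2^-1 * \sum_(1 <= l < p.+1)
    (1 - DK l K ^+ 2) * prod_rho G rho K (w l K) (w l K) = de K.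
  rewrite /de /prodV; under [RHS]eq_bigr => q _.
    rewrite mulr1 eE mulrA mulrCA mulr_sumr; over.
  (* Exchanging nodes and modes collects the nodal heating into one squared norm per mode. *)
  rewrite -mulr_sumr exchange_big /=; congr (_ * _); apply: eq_bigr => l _.
  by rewrite mulr_sumr; apply: eq_bigr => q _; rewrite mulrCA.
have momE : \sum_q m q *: vec_at G K q (up K) = \sum_q m q *: vec_at G K q (um K).
  apply/rowP => d; rewrite -!(prod_rho_cst G rho).
  rewrite [LHS](eq_nodal_dot m upE (fun=> erefl)) nodal_dot_sumZ.
  (* Against a constant only mode 0 survives, and P_0 u has the same product with it as u. *)
  rewrite big_ord_recl big1 ?addr0 ?mul1r => [|l _].
    rewrite -[RHS](prod_rho_proj p_ge1 rho_gt0 K _ (inQ3_delta _ 0 d)).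
    by rewrite /f /w /incr subr0.
  rewrite [X in _ * X](_ : _ = 0) ?mulr0 //.
  by apply: (incr_orthQ p_ge1 rho_gt0 (l := l)); exact: inQ3_delta.
split=> //; split=> //; split=> //; split=> //; split.
  rewrite /de; apply: sumr_ge0 => q _; rewrite mulr1 mulrA mulr_ge0 //.
    exact: rho_mass_ge0.
  by rewrite subr_ge0.
split; last by move=> q em_gt0; split=> //; exact: lt_le_trans (e_le q).
(* The energy change is internal gain minus kinetic loss, which are equal by [diffE] and [deE]. *)
have -> : energy G rho ep up K = energy G rho em um K
    + (de K - (2^-1 * sqnormX_sqrt_rho G rho K (um K)
             - 2^-1 * sqnormX_sqrt_rho G rho K (up K))).
  rewrite /energy.
  have -> : de K = prodV G K (fun q => rho_at G rho K q * val_at G K q (ep K)) (fun=> 1)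
     - prodV G K (fun q => rho_at G rho K q * val_at G K q (em K)) (fun=> 1).
    by rewrite /de /prodV -sumrB; apply: eq_bigr => q _; rewrite !mulr1 -!mulrBr.
  by ring.
by rewrite diffE deE subrr addr0.
Qed.
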